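(* Let $\mathcal{A}=\{0,\ldots,n-1\}$ for some $n\in\mathbb{N}$ and let $\lceil\cdot\rceil:\mathcal{A}\rightarrow\{0,1\}^*$ be a Deflate coding. Then $$\sum_{i\in\mathcal{A},\ \lceil i\rceil\neq[\,]}2^{-\operatorname{len}\lceil i\rceil}\le 1,$$ and equality holds if and only if there is some $k\in\mathcal{A}$ such that $\lceil k\rceil\in\{1\}^+$ (i.e. $\lceil k\rceil$ is a nonempty list consisting only of $1$s).
   Context: $\{0,1\}^*$ is the set of finite bit lists, $[\,]$ is the empty list, $::$ is cons, $+\!\!+$ is concatenation, $\{0,1\}^+$ is the set of nonempty bit lists. For bit lists $a,b$, write $a\preccurlyeq b$ ($a$ is a prefix of $b$) if there is $c\in\{0,1\}^*$ with $a+\!\!+c=b$. The lexicographical ordering $\sqsubseteq$ on $\{0,1\}^*$ is the least relation with $[\,]\sqsubseteq a$ for all $a$; $0::a\sqsubseteq 1::b$ for all $a,b$; and $j::a\sqsubseteq j::b$ whenever $a\sqsubseteq b$ (for $j\in\{0,1\}$). A Deflate coding is a map $\lceil\cdot\rceil:\mathcal{A}\to\{0,1\}^*$ such that: (1) for all $a\neq b$ with $\lceil a\rceil\neq[\,]$, $\lceil a\rceil\not\preccurlyeq\lceil b\rceil$; (2) for all $a,b$, if $\operatorname{len}\lceil a\rceil<\operatorname{len}\lceil b\rceil$ then $\lceil a\rceil\sqsubseteq\lceil b\rceil$; (3) for all $a,b$, if $\operatorname{len}\lceil a\rceil=\operatorname{len}\lceil b\rceil$ and $a\le b$ then $\lceil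 a\rceil\sqsubseteq\lceil b\rceil$; (4) for all $a\in\mathcal{A}$ and $l\in\{0,1\}^+$, if $l\sqsubseteq\lceil a\rceil$ and $\operatorname{len} l=\operatorname{len}\lceil a\rceil$, then there exists $b\in\mathcal{A}$ with $\lceil b\rceil\neq[\,]$ and $\lceil b\rceil\preccurlyeq l$. *)

(* Defs.v *)
From mathcomp Require Import all_boot all_order all_algebra.

Set Implicit Arguments.
Unset Strict Implicit.
Unset Printing Implicit Defensive.

(* Bit lists are MathComp's [bitseq], with 0 = false and 1 = true; the prefix
   order is [seq.prefix]. *)

Inductive lex_le : bitseq -> bitseq -> Prop :=
| lex_le_nil a : lex_le [::] a
| lex_le_01 a b : lex_le (false :: a) (true :: b)
| lex_le_cons j a b : lex_le a b -> lex_le (j :: a) (j :: b).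

(* A symbol coded by [::] is one that does not occur, hence the nonemptiness
   guards: several symbols may share the empty code. *)
Record deflate_coding (n : nat) (code : 'I_n -> bitseq) : Prop := DeflateCoding {
  deflate_prefix_free : forall a b : 'I_n,
    a <> b -> code a <> [::] -> ~ prefix (code a) (code b);
  deflate_shorter_first : forall a b : 'I_n,
    size (code a) < size (code b) -> lex_le (code a) (code b);
  deflate_same_length : forall a b : 'I_n,
    size (code a) = size (code b) -> a <= b -> lex_le (code a) (code b);
  deflate_no_gap : forall (a : 'I_n) (l : bitseq),
    l <> [::] -> lex_le l (code a) -> size l = size (code a) ->
    exists b : 'I_n, code b <> [::] /\ prefix (code b) l
}.

(* Main.v *)
(* For N bounding the code lengths, the words of length N that extend [code i]
   form a cylinder of 2^(N - len) words, and prefix-freeness makes the cylinders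
   of the nonempty codes disjoint.  Hence the Kraft sum is the proportion of
   words of length N having a nonempty code as a prefix.  It is 1 iff all words
   have one: 1^N then yields a code in {1}^+, and conversely, a code 1^m is the
   lexicographically largest word of length m, so the no-gap axiom covers every
   word of length m. *)
Require Import Defs.
From mathcomp Require Import all_boot all_order all_algebra.

Import GRing.Theory Num.Theory.

Local Open Scope ring_scope.

Lemma prefix_of_same (T : eqType) (s t w : seq T) :
  prefix s w -> prefix t w -> (size s <= size t)%N -> prefix s t.
Proof.
rewrite !prefixE => /eqP sw /eqP tw le_st.
by rewrite -tw take_takel // sw.
Qed.

(** Such words are exactly the [s ++ t] with [t] free of length [m]. Writing the length as
    [size s + m] lets the concatenation be a tuple of that type without a cast. *)
Lemma card_tuple_cat_prefix (T : finType) (s : seq T) (m : nat) :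
  #|[set w : (size s + m).-tuple T | prefix s w]| = (#|T| ^ m)%N.
Proof.
pose f (t : m.-tuple T) := cat_tuple (in_tuple s) t.
have f_inj : injective f.
  by move=> t u /(congr1 val) /eqP; rewrite /= eqseq_cat // eqxx => /eqP /val_inj.
rewrite -card_tuple -cardsT -(card_imset _ f_inj); apply: eq_card => w.
rewrite inE; apply/prefixP/imsetP => [[u wE] | [t _ ->]]; last by exists t.
have size_u : size u == m by rewrite -(eqn_add2l (size s)) -size_cat -wE size_tuple.
by exists (Tuple size_u); [rewrite inE | apply: val_inj].
Qed.

Lemma card_tuple_prefix (T : finType) (s : seq T) (N : nat) :
  (size s <= N)%N -> #|[set w : N.-tuple T | prefix s w]| = (#|T| ^ (N - size s))%N.
Proof.
by move=> le_sN; have := card_tuple_cat_prefix T s (N - size s); rewrite subnKC.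
Qed.

(** At each position the head of [l] is either 0, strictly below the 1 in [s], or also 1, which
    leaves the tails to compare. *)
Lemma lex_le_ones (l s : bitseq) :
  size l = size s -> (forall b : bool, b \in s -> b = true) -> lex_le l s.
Proof.
elim: l s => [|x l IHl] [|y s] //= => [_ _|[size_l] ones]; first exact: lex_le_nil.
rewrite (ones y) ?mem_head //; case: x; last exact: lex_le_01.
by apply/lex_le_cons/IHl => // b sb; apply: ones; rewrite inE sb orbT.
Qed.

Section Kraft.

Variables (I : finType) (code : I -> bitseq) (N : nat).
Hypothesis size_code : forall i, (size (code i) <= N)%N.
Hypothesis prefix_free :
  forall i j, i <> j -> code i <> [::] -> ~ prefix (code i) (code j).

(** The guard makes the cylinder of an empty code empty, so unions can range over all of [I]. *)
Let cylinder (i : I) :=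
  [set w : N.-tuple bool | (code i != [::]) && prefix (code i) w].

(** Of two prefixes of a common word, the shorter is a prefix of the longer. *)
Lemma cylinder_disjoint (i j : I) : i != j -> [disjoint cylinder i & cylinder j].
Proof.
move=> neq_ij; apply/pred0P => w /=; rewrite !inE; apply/negbTE/negP.
case/andP=> /andP[/eqP ci pi] /andP[/eqP cj pj].
have [le_ij|/ltnW le_ji] := leqP (size (code i)) (size (code j)).
  by apply: (prefix_free i j) => //; [apply/eqP | apply: prefix_of_same pi pj _].
by apply: (prefix_free j i) => //; [apply/nesym/eqP | apply: prefix_of_same pj pi _].
Qed.

Lemma kraft_sum_card :
  \sum_(i | code i != [::]) (2 : rat) ^- size (code i) =
  #|\bigcup_i cylinder i|%:R / 2 ^+ N.
Proof.
(* By disjointness, the cardinality of the union splits into one term per index, to be matched with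
   the Kraft terms one by one. *)
rewrite -sum1_card (partition_disjoint_bigcup _ _ cylinder_disjoint).
rewrite natr_sum mulr_suml big_mkcond /=; apply: eq_bigr => i _.
rewrite sum1_card; case: ifPn => [ci|/negbTE ci]; last first.
  by rewrite eq_card0 ?mul0r // => w; rewrite inE ci.
have -> : #|cylinder i| = (2 ^ (N - size (code i)))%N.
  by rewrite -card_bool -card_tuple_prefix //; apply: eq_card => w; rewrite !inE ci.
by rewrite natrX expfB_cond ?pnatr_eq0 ?size_code // mulrAC divff ?mul1r // expf_neq0 ?pnatr_eq0.
Qed.

Lemma kraft_le1 : \sum_(i | code i != [::]) (2 : rat) ^- size (code i) <= 1.
Proof.
rewrite kraft_sum_card ler_pdivrMr ?exprn_gt0 ?ltr0n // mul1r -natrX ler_nat.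
by rewrite (leq_trans (max_card _)) // card_tuple card_bool.
Qed.

Lemma kraft_eq1P :
  \sum_(i | code i != [::]) (2 : rat) ^- size (code i) = 1 <->
  forall w : N.-tuple bool, exists i, code i <> [::] /\ prefix (code i) w.
Proof.
have X_neq0 : (2 : rat) ^+ N != 0 by rewrite expf_neq0 ?pnatr_eq0.
have cardE : (2 ^ N)%N = #|[set: N.-tuple bool]|.
  by rewrite cardsT card_tuple card_bool.
rewrite kraft_sum_card; split=> [/divr1_eq /eqP|cover].
  rewrite -natrX eqr_nat cardE => /eqP card_eq w.
  (* A subset with as many elements as the whole set is the whole set. *)
  have /eqP covT : \bigcup_i cylinder i == setT by rewrite eqEcard subsetT card_eq /=.
  have : w \in \bigcup_i cylinder i by rewrite covT inE.
  by case/bigcupP=> i _; rewrite inE => /andP[/eqP ci pi]; exists i.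
suff -> : \bigcup_i cylinder i = setT by rewrite -cardE natrX divff.
apply/setP => w; rewrite inE; have [i [/eqP ci pi]] := cover w.
by apply/bigcupP; exists i; rewrite // inE ci.
Qed.

End Kraft.

Theorem theorem2 (n : nat) (code : 'I_n -> bitseq) (hcode : deflate_coding code) :
  \sum_(i < n | code i != [::]) (2 : rat) ^- size (code i) <= 1 /\
  (\sum_(i < n | code i != [::]) (2 : rat) ^- size (code i) = 1 <->
   exists k : 'I_n, code k <> [::] /\ forall b : bool, b \in code k -> b = true).
Proof.
pose N := (\max_i size (code i))%N.
have size_code i : (size (code i) <= N)%N by exact: (leq_bigmax i).
case: hcode => prefix_free _ _ no_gap.
split; first exact: kraft_le1 size_code prefix_free.
apply: (iff_trans (kraft_eq1P _ _ _ size_code prefix_free)); split=> [cover|[k [ck ones]] w].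
  have [k [ck /prefixP[s wE]]] := cover (nseq_tuple N true).
  exists k; split=> // b kb; have : b \in nseq N true by rewrite wE mem_cat kb.
  by rewrite mem_nseq => /andP[_ /eqP].
(* The no-gap axiom is applied to [w] cut to the length of the all-ones code of [k]; a code that is
   a prefix of this cut is one of [w]. *)
have size_l : size (take (size (code k)) w) = size (code k).
  by rewrite size_takel // size_tuple.
have l_neq0 : take (size (code k)) w <> [::].
  by move=> l0; apply/ck/size0nil; rewrite -size_l l0.
have [b [cb pb]] := no_gap k _ l_neq0 (lex_le_ones _ _ size_l ones) size_l.
by exists b; split=> //; apply: prefix_trans pb (prefix_take _ _).
Qed.
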